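(* Let $d\ge1$, and let $$\rho_0^d=\sum_{i\in I}w_i\varphi_{i,0}^d,\qquad \widetilde\rho_0^{\,d}=\sum_{i\in I}\widetilde w_i\widetilde\varphi_{i,0}^d,$$ where $\varphi_{i,0}^d$ and $\widetilde\varphi_{i,0}^d$ are the densities of $\mathcal N(m_i^d,\Sigma_i^d+C^d)$ and $\mathcal N(\widetilde m_i^d,\widetilde\Sigma_i^d+C^d)$ respectively. Then $\mathcal E_{\mathrm{init}}^d:=\mathrm{KL}(\rho_0^d\,\|\,\widetilde\rho_0^{\,d})$ satisfies $$\mathcal E_{\mathrm{init}}^d\le\mathrm{KL}(w\,\|\,\widetilde w)+\sum_{i\in I}w_i\,\mathrm{KL}\big(\varphi_{i,0}^d\,\|\,\widetilde\varphi_{i,0}^d\big),\qquad \mathrm{KL}(w\,\|\,\widetilde w)=\sum_{i\in I}w_i\log\Big(\frac{w_i}{\widetilde w_i}\Big).$$ Moreover, if $\Delta\Sigma_i^d=\mathrm{Diag}(\Delta\sigma_{i1},\dots,\Delta\sigma_{id})$ with $\sigma_{ij}+\Delta\sigma_{ij}>0$ for all $i,j$, then for every $i\in I$ $$\mathrm{KL}\big(\varphi_{i,0}^d\,\|\,\widetilde\varphi_{i,0}^d\big)=\frac12\sum_{j=1}^d\Bigg[\frac{(\Delta m_{ij})^2}{\sigma_{ij}+\Delta\sigma_{ij}+\lambda_j}+\log\Big(1+\frac{\Delta\sigma_{ij}}{\sigma_{ij}+\lambda_j}\Big)-\frac{\Delta\sigma_{ij}}{\sigma_{ij}+\Delta\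sigma_{ij}+\lambda_j}\Bigg].$$
   Context: $I$ is a finite or countably infinite index set, with weights $w_i>0$, $\sum_{i\in I}w_i=1$. For $i\in I$, $j\ge1$, $m_{ij}\in\mathbb R$ and $\sigma_{ij}>0$ satisfy $\sum_{j\ge1}m_{ij}^2<\infty$, $\sum_{j\ge1}\sigma_{ij}<\infty$ for every $i$; $m_i^d=(m_{i1},\dots,m_{id})$, $\Sigma_i^d=\mathrm{Diag}(\sigma_{i1},\dots,\sigma_{id})$. $C^d=\mathrm{Diag}(\lambda_1,\dots,\lambda_d)$ with $\lambda_j>0$ and $\sum_{j\ge1}\lambda_j<\infty$. Perturbed parameters: $\widetilde m_i^d=m_i^d+\Delta m_i^d$ with $\Delta m_i^d=(\Delta m_{i1},\dots,\Delta m_{id})\in\mathbb R^d$; $\widetilde\Sigma_i^d=\Sigma_i^d+\Delta\Sigma_i^d$, a covariance matrix; $\widetilde w_i=w_i+\Delta w_i$ with $\widetilde w_i>0$ and $\sum_{i\in I}\widetilde w_i=1$. $\mathrm{KL}$ denotes the Kullback--Leibler divergence. *)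

(* Defs.v *)
From HB Require Import structures.
From mathcomp Require Import all_boot all_order all_algebra.
From mathcomp Require Import all_classical all_reals all_analysis.

Set Implicit Arguments.
Unset Strict Implicit.
Unset Printing Implicit Defensive.

Import Order.TTheory GRing.Theory Num.Theory.
Import numFieldNormedType.Exports.

Local Open Scope classical_set_scope.
Local Open Scope ring_scope.

(* R^n as a measurable space: n-tuples with the product (= Borel) sigma-algebra. *)
Notation Rn R n := (n.-tuple (measurableTypeR R)).

Definition rv_of (R : realType) n (x : Rn R n) : 'rV[R]_n := \row_j tnth x j.

Section lebesgue_step.
Context (R : realType) (n : nat) (mu : {sigma_finite_measure set (Rn R n) -> \bar R}).

Definition cons_pair (p : measurableTypeR R * Rn R n) : Rn R n.+1 :=
  [tuple of p.1 :: p.2].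

Lemma measurable_cons_pair : measurable_fun setT cons_pair.
Proof. exact: (measurable_cons measurable_fst measurable_snd). Qed.

Definition lebesgue_step : set (Rn R n.+1) -> \bar R :=
  pushforward (@lebesgue_measure R \x mu)%E cons_pair.

Let lebesgue_step0 : lebesgue_step set0 = 0%E.
Proof. by rewrite /lebesgue_step /pushforward preimage_set0 measure0. Qed.

Let lebesgue_step_ge0 A : (0 <= lebesgue_step A)%E.
Proof. by rewrite /lebesgue_step /pushforward measure_ge0. Qed.

Let lebesgue_step_sigma_additive : semi_sigma_additive lebesgue_step.
Proof.
move=> F mF tF mUF; rewrite /lebesgue_step /pushforward preimage_bigcup.
apply: measure_semi_sigma_additive.
- by move=> k; rewrite -[X in measurable X]setTI; exact: measurable_cons_pair.
- apply/trivIsetP => /= i j _ _ ij; rewrite -preimage_setI.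
  by move/trivIsetP : tF => /(_ _ _ _ _ ij) ->//; rewrite preimage_set0.
- rewrite -preimage_bigcup -[X in measurable X]setTI.
  exact: measurable_cons_pair.
Qed.

HB.instance Definition _ := isMeasure.Build _ _ _ lebesgue_step
  lebesgue_step0 lebesgue_step_ge0 lebesgue_step_sigma_additive.

Let lebesgue_step_sigma_finite : sigma_finite setT lebesgue_step.
Proof.
have /sigma_finiteP[F [TF ndF Foo]] := sigma_finiteT (@lebesgue_measure R).
have /sigma_finiteP[G [TG ndG Goo]] := sigma_finiteT mu.
exists (fun k => [set x : Rn R n.+1 | F k (thead x) /\ G k [tuple of behead x]]).
  apply/seteqP; split=> // x _.
  have [i _ Fi] : (\bigcup_i F i) (thead x) by rewrite -TF.
  have [j _ Gj] : (\bigcup_i G i) [tuple of behead x] by rewrite -TG.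
  exists (maxn i j) => //; split.
    by move: Fi; exact/subsetPset/ndF/leq_maxl.
  by move: Gj; exact/subsetPset/ndG/leq_maxr.
move=> k; have [mF Fk] := Foo k; have [mG Gk] := Goo k; split.
  apply: measurableI.
    rewrite -[X in measurable X]setTI.
    exact: (measurable_tnth (ord0 : 'I_n.+1) measurableT mF).
  rewrite -[X in measurable X]setTI.
  exact: (@measurable_behead _ (measurableTypeR R) n measurableT _ mG).
rewrite /lebesgue_step /pushforward.
rewrite (_ : _ @^-1` _ = F k `*` G k).
  by rewrite product_measure1E// lte_mul_pinfty// ge0_fin_numE.
have consK (a : R) (t : Rn R n) :
    [tuple of behead (cons_pair (a, t))] = t :> Rn R n by exact: val_inj.
by apply/seteqP; split=> -[a t] /=; rewrite consK /cons_pair theadE.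
Qed.

HB.instance Definition _ := Measure_isSigmaFinite.Build _ _ _ lebesgue_step
  lebesgue_step_sigma_finite.

End lebesgue_step.

(* Lebesgue measure on R^n, as the n-fold product of lebesgue_measure; R^0 is a
   point of mass 1. *)
Fixpoint lebesgue_Rn (R : realType) (n : nat) :
    {sigma_finite_measure set (Rn R n) -> \bar R} :=
  match n with
  | 0 => dirac ([tuple] : Rn R 0)
  | n'.+1 => lebesgue_step (lebesgue_Rn R n')
  end.

(* p log (p / q) with the usual conventions 0 log (0 / q) = 0 and
   p log (p / 0) = +oo for p > 0; needed because ln 0 = 0 and x / 0 = 0 here. *)
Definition kl_integrand (R : realType) (p q : R) : \bar R :=
  if p == 0 then 0%E else if q == 0 then +oo%E else (p * ln (p / q))%:E.

(* KL(p || q) for two probability densities with respect to mu. *)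
Definition KL (R : realType) d (T : measurableType d)
    (mu : {measure set T -> \bar R}) (p q : T -> R) : \bar R :=
  (\int[mu]_x kl_integrand (p x) (q x))%E.

(* esum is only meaningful for nonnegative terms; for terms of arbitrary sign
   the sum is split, as in the library's definition of the integral. *)
Definition signed_esum (R : realType) (I : choiceType) (f : I -> \bar R) : \bar R :=
  ((\esum_(i in [set: I]) f^\+ i) - (\esum_(i in [set: I]) f^\- i))%E.

Definition KL_weights (R : realType) (I : choiceType) (w w' : I -> R) : \bar R :=
  signed_esum (fun i => (w i * ln (w i / w' i))%:E).

Definition is_covariance (R : realType) n (S : 'M[R]_n) : Prop :=
  S^T = S /\ forall v : 'rV[R]_n, 0 <= (v *m S *m v^T) 0 0.

(* Density of N(m, S), for S symmetric positive definite. *)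
Definition gaussian_pdf (R : realType) n (m : 'rV[R]_n) (S : 'M[R]_n)
    (x : Rn R n) : R :=
  let y := rv_of x - m in
  expR (- ((y *m invmx S *m y^T) 0 0) / 2) / Num.sqrt ((2 * pi) ^+ n * \det S).

(* sum_i w_i phi_i; `fine` is harmless for the densities phi_i = N(m_i, S_i + C),
   which are bounded uniformly in i. *)
Definition mixture (R : realType) (I : choiceType) (T : Type)
    (w : I -> R) (phi : I -> T -> R) (x : T) : R :=
  fine (\esum_(i in [set: I]) (w i * phi i x)%:E)%E.

(* The first d entries of a sequence a_1, a_2, ..., stored as a 0, a 1, ... *)
Definition trunc_rv (R : realType) d (a : nat -> R) : 'rV[R]_d := \row_(j < d) a j.

Definition trunc_diag (R : realType) d (a : nat -> R) : 'M[R]_d :=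
  diag_mx (trunc_rv d a).

(* Main.v *)
Require Import Defs.
From HB Require Import structures.
From mathcomp Require Import all_boot all_order all_algebra.
From mathcomp Require Import all_classical all_reals all_analysis.
From mathcomp Require Import measurable_realfun ring lra.

(** The inequality is the chain rule for the Kullback-Leibler divergence
    followed by forgetting the index: KL between the mixtures is at most KL
    between the joint laws of (component, point), which is KL(w || w~) plus
    the w-average of the divergences of the components. Pointwise this is
    the log-sum inequality. To keep every sum and integral meaningful when
    some divergences are infinite, p log (p / q) is replaced by [kl_gap p
    q], that is p log (p / q) - p + q. This is nonnegative and has the same
    integral between probability densities ([KL_gap], and [KL_weights_gap]
    for the weights), so that Tonelli's theorem applies to the countable
    sums; see [kl_gap_esum] and [KL_mixture_le]. The mixtures may be
    infinite on a null set only.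

    This argument uses that the densities of N(m, S) integrate to 1, also
    for the perturbed covariances, which need not be diagonal. As S is
    positive definite, the Gaussian integral over R^n follows by induction
    on n by completing the square in one variable, using the Schur
    complement ([posdef_complete_square], [integral_gaussian_Rn]).

    For diagonal covariances the densities are products, log (phi / phi~) is
    a sum of quadratic functions of single coordinates, and the formula
    follows from the mean and the variance of one-dimensional Gaussians.
    These two moments are obtained by integrating 1 + u <= exp u, where the
    exponential of a linear or quadratic function times a Gaussian density
    is again a multiple of a Gaussian density ([npdf_moment1],
    [npdf_moment2], [KL_gaussian_diag]). *)

Set Implicit Arguments.
Unset Strict Implicit.
Unset Printing Implicit Defensive.

Import Order.TTheory GRing.Theory Num.Theory.
Import numFieldNormedType.Exports.

Local Open Scope classical_set_scope.
Local Open Scope ring_scope.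

(** * The nonnegative divergence integrand *)

Section kl_gap.
Variable R : realType.
Implicit Types p q a b : R.

(** This is p log (p / q) - p + q with the conventions of [kl_integrand] at
    0. Between two probability densities the extra terms - p + q integrate to 0,
    and they make the integrand nonnegative, so that sums and integrals of it
    may be split and exchanged freely in [0, +oo]. *)
Definition kl_gap p q : \bar R :=
  if p == 0 then q%:E else if q == 0 then +oo%E
  else (p * ln (p / q) - p + q)%:E.

(** The convex function u |-> u ln u - u lies above its tangent at t;
    multiplying by b at u = a / b gives the perspective form used here. It
    reduces to ln z <= z - 1 at z = t b / a. *)
Lemma kl_tangent a b t : 0 < a -> 0 < b -> 0 < t ->
  a * ln t - t * b + b <= a * ln (a / b) - a + b.
Proof.
move=> a0 b0 t0.
have e : ln (a / b) = ln t - ln (t * b / a).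
  rewrite -ln_div ?posrE ?divr_gt0 ?mulr_gt0//; congr ln.
  by field; rewrite !gt_eqF.
have h : ln (t * b / a) <= t * b / a - 1.
  have /le_ln1Dx : -1 < t * b / a - 1.
    by rewrite ltrBrDr addrC subrr divr_gt0 ?mulr_gt0.
  by rewrite addrC subrK.
have : a * ln (t * b / a) <= t * b - a.
  rewrite (le_trans (ler_wpM2l (ltW a0) h))//.
  by rewrite mulrBr mulr1 mulrCA divff ?gt_eqF// mulr1.
rewrite e mulrBr; lra.
Qed.

Lemma kl_gap_ge0 p q : 0 <= p -> 0 <= q -> (0 <= kl_gap p q)%E.
Proof.
rewrite /kl_gap; case: eqVneq => [_ _|p0 p_ge0]; first by rewrite lee_fin.
case: eqVneq => [_ _|q0 q_ge0]; first exact: leey.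
have p_gt0 : 0 < p by rewrite lt0r p0.
have q_gt0 : 0 < q by rewrite lt0r q0.
by have := kl_tangent p_gt0 q_gt0 ltr01; rewrite ln1 lee_fin; lra.
Qed.

Lemma kl_gapE p q : (kl_integrand p q + q%:E = kl_gap p q + p%:E)%E.
Proof.
rewrite /kl_gap /kl_integrand; case: eqVneq => [->|p0].
  by rewrite add0e adde0.
by case: eqVneq => // q0; rewrite -!EFinD; congr EFin; ring.
Qed.

(** Both sides are sums of nonnegative terms: this is the additive form of
    kl_integrand = kl_gap + p - q in which no infinite quantities are
    subtracted. *)
Lemma kl_integrand_split p q (k := kl_integrand p q) :
  (maxe k 0 + q%:E = kl_gap p q + p%:E + maxe (- k) 0)%E.
Proof.
rewrite -kl_gapE -/k /k /kl_integrand; case: eqVneq => _.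
  by rewrite oppe0 maxxx adde0.
case: eqVneq => [->|q0] /=.
  by rewrite max_l ?leey// max_r ?leNye.
set z := p * _.
have [z0|/ltW z0] := leP z 0.
  rewrite max_r ?lee_fin// max_l ?lee_fin ?oppr_ge0//.
  by rewrite -!EFinD; congr EFin; lra.
rewrite max_l ?lee_fin// max_r ?lee_fin ?oppr_le0//.
by rewrite -!EFinD; congr EFin; lra.
Qed.

(** Nonnegativity of [kl_gap] bounds the negative part of the divergence
    integrand by the reference density, hence makes it integrable. *)
Lemma kl_integrand_neg_le p q : 0 <= p -> 0 <= q ->
  (maxe (- kl_integrand p q) 0 <= q%:E)%E.
Proof.
move=> p0 q0; rewrite ge_max lee_fin q0 andbT.
have := kl_gap_ge0 p0 q0; rewrite /kl_gap /kl_integrand.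
case: eqVneq => _; first by rewrite oppe0 lee_fin.
case: eqVneq => _ /=; first by rewrite leNye.
by rewrite !lee_fin; lra.
Qed.

(** The chain rule log (a p / (b q)) = log (a / b) + log (p / q), with the
    linear terms arranged so that everything added is nonnegative. *)
Lemma kl_gap_scale p q a b : 0 < p -> 0 < q -> 0 < a -> 0 < b ->
  (kl_gap (a * p) (b * q) + (b * p)%:E + (a * q)%:E =
   a%:E * kl_gap p q + p%:E * kl_gap a b + (a * p)%:E + (b * q)%:E)%E.
Proof.
move=> p0 q0 a0 b0.
rewrite /kl_gap !mulf_eq0 !gt_eqF//= -!EFinM -!EFinD; congr EFin.
rewrite [a * p / (b * q)](_ : _ = (a / b) * (p / q)); last first.
  by field; rewrite !gt_eqF.
by rewrite lnM ?posrE ?divr_gt0//; ring.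
Qed.

Lemma sub_of_split (a b k : \bar R) :
  (a + 1 = k + 1 + b)%E -> b \is a fin_num -> (a - b = k)%E.
Proof.
case: a => [a||]; case: b => [b||]; case: k => [k||] //=.
by move=> [e] _; congr EFin; lra.
Qed.

End kl_gap.

(** * Countable sums *)

Section countable_sums.
Variables (R : realType) (I : countType).
Local Open Scope ereal_scope.

(** Transports a countable family to a sequence along [pickle], with 0 at the
    integers that encode no index; series over nat then provide scaling,
    measurability and the exchange with integrals. *)
Definition nat_ext (f : I -> \bar R) (n : nat) : \bar R :=
  if pickle_inv n is Some i then f i else 0.

Lemma nat_ext_ge0 f : (forall i, 0 <= f i) -> forall n, 0 <= nat_ext f n.
Proof. by move=> f0 n; rewrite /nat_ext; case: pickle_inv. Qed.

Lemma esum_nat_ext (f : I -> \bar R) : (forall i, 0 <= f i) ->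
  \esum_(i in [set: I]) f i = \sum_(0 <= n <oo) nat_ext f n.
Proof.
move=> f0; rewrite (nneseries_esumT (nat_ext_ge0 f0)).
rewrite [RHS](_ : _ = \esum_(n in range (@pickle I)) nat_ext f n); last first.
  rewrite [RHS]esum_mkcond; apply: eq_esum => n _.
  case: ifPn => //; rewrite notin_setE /nat_ext.
  case E : (pickle_inv n) => [i|] // [].
  by exists i => //; have := pickle_invK (T := I) n; rewrite E.
rewrite (reindex_esum [set: I] (range (@pickle I)) pickle).
  by apply: eq_esum => i _; rewrite /nat_ext pickleK_inv.
split=> [i _|i j _ _|n [i _ <-]]; [by exists i| |by exists i].
exact: (pcan_inj pickleK_inv).
Qed.

Lemma esumZl (c : R) (f : I -> \bar R) : (0 <= c)%R -> (forall i, 0 <= f i) ->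
  \esum_(i in [set: I]) (c%:E * f i) = c%:E * \esum_(i in [set: I]) f i.
Proof.
move=> c0 f0; rewrite !esum_nat_ext// => [|i]; last exact: mule_ge0.
rewrite -nneseriesZl => [|n _]; last exact: nat_ext_ge0.
apply: eq_eseriesr => n _; rewrite /nat_ext.
by case: pickle_inv => //; rewrite mule0.
Qed.

End countable_sums.

Section countable_sum_integrals.
Context d (T : measurableType d) (R : realType) (I : countType).
Variable mu : {measure set T -> \bar R}.
Variable f : I -> T -> \bar R.
Hypothesis mf : forall i, measurable_fun setT (f i).
Hypothesis f0 : forall i x, (0 <= f i x)%E.
Local Open Scope ereal_scope.

Let mnat_ext n : measurable_fun setT (fun x => nat_ext (f ^~ x) n).
Proof. by rewrite /nat_ext; case: pickle_inv. Qed.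

Lemma measurable_esum :
  measurable_fun setT (fun x => \esum_(i in [set: I]) f i x).
Proof.
under eq_fun do rewrite esum_nat_ext//.
by apply: ge0_emeasurable_sum => // n x _ _; exact: nat_ext_ge0.
Qed.

Lemma integral_esum :
  \int[mu]_x (\esum_(i in [set: I]) f i x) =
  \esum_(i in [set: I]) \int[mu]_x f i x.
Proof.
under eq_integral do rewrite esum_nat_ext//.
rewrite integral_nneseries// => [|n x _]; last exact: nat_ext_ge0.
rewrite esum_nat_ext => [|i]; last exact: integral_ge0.
apply: eq_eseriesr => n _; rewrite /nat_ext; case: pickle_inv => //.
exact: integral0.
Qed.

End countable_sum_integrals.

Section log_sum.
Variables (R : realType) (I : countType) (a b : I -> R).
Hypotheses (a0 : forall i, 0 < a i) (b0 : forall i, 0 < b i).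
Local Open Scope ereal_scope.

(** Log-sum inequality for countably many terms. Each term lies above the
    affine function of (a i, b i) given by [kl_tangent] at the slope t = A / B
    of the total masses; these affine functions add up to kl_gap A B. *)
Lemma kl_gap_esum (A B : R) : (0 < A)%R -> (0 < B)%R ->
  \esum_(i in [set: I]) (a i)%:E = A%:E ->
  \esum_(i in [set: I]) (b i)%:E = B%:E ->
  kl_gap A B <= \esum_(i in [set: I]) kl_gap (a i) (b i).
Proof.
move=> A0 B0 sA sB.
pose t := (A / B)%R; have t0 : (0 < t)%R by rewrite divr_gt0.
(* ln t has no sign, but esum is additive on nonnegative terms only: its
   positive and negative parts are put on opposite sides *)
pose u := Num.max (ln t) 0%R; pose v := Num.max (- ln t)%R 0%R.
have uv : (ln t = u - v)%R.
  rewrite /u /v; have [z0|z0] := leP (ln t) 0%R.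
    by rewrite max_l ?oppr_ge0//; lra.
  by rewrite max_r ?oppr_le0 ?ltW//; lra.
have u0 : (0 <= u)%R by rewrite /u le_max lexx orbT.
have v0 : (0 <= v)%R by rewrite /v le_max lexx orbT.
have g0 i : 0 <= kl_gap (a i) (b i) by rewrite kl_gap_ge0// ltW.
have aE0 i : 0 <= (a i)%:E by rewrite lee_fin ltW.
have bE0 i : 0 <= (b i)%:E by rewrite lee_fin ltW.
have : \esum_(i in [set: I]) (u%:E * (a i)%:E + (b i)%:E) <=
       \esum_(i in [set: I])
         (kl_gap (a i) (b i) + (v%:E * (a i)%:E + t%:E * (b i)%:E)).
  apply: le_esum => i _; have := kl_tangent (a0 i) (b0 i) t0.
  rewrite /kl_gap !gt_eqF// -!EFinM -!EFinD lee_fin uv; lra.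
rewrite !esumD; try by move=> i _; rewrite ?adde_ge0 ?mule_ge0 ?lee_fin// ltW.
rewrite !esumZl ?(ltW t0)// sA sB.
case: (\esum_(i in _) kl_gap _ _) => [k|_|]; [|exact: leey|by []].
rewrite /kl_gap !gt_eqF// -!EFinM -!EFinD !lee_fin -/t uv /t => h.
have : (A / B * B = A)%R by rewrite divfK ?gt_eqF.
by lra.
Qed.

End log_sum.

(** * Divergence as an integral of a nonnegative function *)

Section integrals.
Context d (T : measurableType d) (R : realType).
Variable mu : {measure set T -> \bar R}.
Implicit Types p q : T -> R.

Lemma integral_density_scale p c : measurable_fun setT p ->
  (forall x, 0 <= p x) -> (\int[mu]_x (p x)%:E = 1)%E -> 0 <= c ->
  (\int[mu]_x (c * p x)%:E = c%:E)%E.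
Proof.
move=> mp p0 p1 c0; under eq_integral do rewrite EFinM.
rewrite ge0_integralZl_EFin// ?p1 ?mule1//; last exact/measurable_EFinP.
by move=> x _; rewrite lee_fin.
Qed.

Lemma measurable_kl_gap p q : measurable_fun setT p -> measurable_fun setT q ->
  (forall x, 0 <= p x) -> (forall x, 0 <= q x) ->
  measurable_fun setT (fun x => kl_gap (p x) (q x)).
Proof.
move=> mp mq p0 q0.
(* the quotient is rewritten as a difference of logarithms on the set where
   both densities are positive *)
rewrite (_ : (fun _ => _) = (fun x => if p x == 0 then (q x)%:E else
    if q x == 0 then +oo%E else
    (p x * (ln (p x) - ln (q x)) - p x + q x)%:E)); last first.
  apply/funext => x; rewrite /kl_gap.
  case: eqVneq => // px; case: eqVneq => // qx.
  by rewrite ln_div// posrE lt0r ?px ?qx/=.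
apply: measurable_fun_ifT; first exact: measurable_fun_eqr.
  exact/measurable_EFinP.
apply: measurable_fun_ifT => //; first exact: measurable_fun_eqr.
apply/measurable_EFinP/measurable_funD => //.
apply: measurable_funB => //; apply: measurable_funM => //.
by apply: measurable_funB; exact: measurableT_comp.
Qed.

Lemma measurable_kl_integrand p q :
  measurable_fun setT p -> measurable_fun setT q ->
  (forall x, 0 <= p x) -> (forall x, 0 <= q x) ->
  measurable_fun setT (fun x => kl_integrand (p x) (q x)).
Proof.
move=> mp mq p0 q0.
rewrite (_ : (fun _ => _) = (fun x => kl_gap (p x) (q x) + (p x - q x)%:E)%E).
  apply: emeasurable_funD; first exact: measurable_kl_gap.
  exact/measurable_EFinP/measurable_funB.
apply/funext => x.
have := kl_gapE (p x) (q x); rewrite EFinB addeA => <-.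
by rewrite addeK.
Qed.

(** The integrals of - p and q cancel. Integrating [kl_integrand_split] gives
    this without assuming that either side is finite, since only the integral
    of the negative part, at most 1, is subtracted. *)
Lemma KL_gap p q : measurable_fun setT p -> measurable_fun setT q ->
  (forall x, 0 <= p x) -> (forall x, 0 <= q x) ->
  (\int[mu]_x (p x)%:E = 1)%E -> (\int[mu]_x (q x)%:E = 1)%E ->
  KL mu p q = (\int[mu]_x kl_gap (p x) (q x))%E.
Proof.
move=> mp mq p0 q0 ip iq; rewrite /KL integralE.
set k := fun x => kl_integrand (p x) (q x).
have mk : measurable_fun setT k by exact: measurable_kl_integrand.
have mkp : measurable_fun setT k^\+%E by exact: measurable_funepos.
have mkn : measurable_fun setT k^\-%E by exact: measurable_funeneg.
have mg : measurable_fun setT (fun x => kl_gap (p x) (q x)).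
  exact: measurable_kl_gap.
have g0 x : (0 <= kl_gap (p x) (q x))%E by exact: kl_gap_ge0.
have mpE : measurable_fun setT (EFin \o p) by exact/measurable_EFinP.
have mqE : measurable_fun setT (EFin \o q) by exact/measurable_EFinP.
apply: sub_of_split.
  rewrite -{1}iq -ip -!ge0_integralD//=.
  - by apply: eq_integral => x _; rewrite funeposE funenegE kl_integrand_split.
  - by move=> x _; rewrite adde_ge0// lee_fin.
  - exact: emeasurable_funD.
  - by move=> x _; rewrite lee_fin.
  - by move=> x _; rewrite lee_fin.
rewrite ge0_fin_numE ?integral_ge0//.
apply: (@le_lt_trans _ _ 1%E); last exact: ltry.
rewrite -iq; apply: ge0_le_integral => //= x _.
by rewrite funenegE kl_integrand_neg_le.
Qed.

End integrals.

Section signed_sums.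
Variables (R : realType) (I : choiceType).

Lemma signed_esum_ge0 (f : I -> \bar R) : (forall i, 0 <= f i)%E ->
  signed_esum f = (\esum_(i in [set: I]) f i)%E.
Proof.
move=> f0; rewrite /signed_esum (_ : (\esum_(i in _) f^\- i = 0)%E); last first.
  by apply: esum1 => i _; rewrite funenegE max_r// leeNl oppe0.
by rewrite sube0; apply: eq_esum => i _; rewrite funeposE max_l.
Qed.

(** The discrete counterpart of [KL_gap], for the counting sum over I. *)
Lemma KL_weights_gap (w v : I -> R) :
  (forall i, 0 < w i) -> (forall i, 0 < v i) ->
  (\esum_(i in [set: I]) (w i)%:E = 1)%E ->
  (\esum_(i in [set: I]) (v i)%:E = 1)%E ->
  KL_weights w v = (\esum_(i in [set: I]) kl_gap (w i) (v i))%E.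
Proof.
move=> w0 v0 sw sv; rewrite /KL_weights /signed_esum.
set k := fun i => _%:E.
have kE i : k i = kl_integrand (w i) (v i) by rewrite /kl_integrand !gt_eqF.
have g0 i : (0 <= kl_gap (w i) (v i))%E by rewrite kl_gap_ge0// ltW.
apply: sub_of_split.
  rewrite -{1}sv -sw -!esumD//=; try by
    move=> i _; rewrite ?adde_ge0 ?lee_fin// ltW.
  by apply: eq_esum => i _; rewrite funeposE funenegE kE kl_integrand_split.
rewrite ge0_fin_numE ?esum_ge0//.
apply: (@le_lt_trans _ _ 1%E); last exact: ltry.
rewrite -sv; apply: le_esum => i _.
by rewrite funenegE kE kl_integrand_neg_le// ltW.
Qed.

End signed_sums.

(** * Divergence between mixtures *)

Lemma le_of_balance (R : realType) (X Y : \bar R) (v w g : R) :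
  (X + v%:E + w%:E = Y + g%:E + w%:E + v%:E)%E -> (X <= g%:E + Y)%E.
Proof.
case: X => [x||]; case: Y => [y||] //= e; rewrite ?leNye ?leey//.
by move: e => [e]; rewrite lee_fin; lra.
Qed.

Section mixtures.
Context d (T : measurableType d) (R : realType) (I : countType).
Variable mu : {measure set T -> \bar R}.

Section one_mixture.
Variables (w : I -> R) (p : I -> T -> R).
Hypotheses (w0 : forall i, 0 < w i) (p0 : forall i x, 0 < p i x).
Hypothesis w1 : (\esum_(i in [set: I]) (w i)%:E = 1)%E.
Hypothesis mp : forall i, measurable_fun setT (p i).
Hypothesis p1 : forall i, (\int[mu]_x (p i x)%:E = 1)%E.

Let P x := (\esum_(i in [set: I]) (w i * p i x)%:E)%E.

Let wp0 i x : (0 <= (w i * p i x)%:E)%E.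
Proof. by rewrite lee_fin mulr_ge0// ltW. Qed.

Let mwp i : measurable_fun setT (fun x => (w i * p i x)%:E).
Proof. exact/measurable_EFinP/measurable_funM. Qed.

Let P0 x : (0 <= P x)%E. Proof. exact: esum_ge0. Qed.

Let mP : measurable_fun setT P.
Proof. exact: measurable_esum. Qed.

Let iP : (\int[mu]_x P x = 1)%E.
Proof.
rewrite integral_esum// -w1; apply: eq_esum => i _.
apply: integral_density_scale => //; last exact: ltW.
by move=> x; rewrite ltW.
Qed.

Lemma mixture_ge0 x : 0 <= mixture w p x.
Proof. exact/fine_ge0/P0. Qed.

Lemma measurable_mixture : measurable_fun setT (mixture w p).
Proof. by apply: measurableT_comp => //; exact: fine_measurable. Qed.

(** A mixture of densities may be infinite at some points, where [mixture] is
    set to 0; its integral is 1, so these points form a null set. *)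
Lemma mixture_ae : {ae mu, forall x,
  (\esum_(i in [set: I]) (w i * p i x)%:E = (mixture w p x)%:E)%E}.
Proof.
have /(integrable_ae measurableT) : mu.-integrable setT P.
  apply/integrableP; split => //.
  by under eq_integral do rewrite gee0_abs//; rewrite iP ltry.
by apply: filterS => x /(_ Logic.I) Pfin; rewrite /mixture fineK.
Qed.

Lemma integral_mixture : (\int[mu]_x (mixture w p x)%:E = 1)%E.
Proof.
rewrite -iP; apply: ae_eq_integral => //.
  exact/measurable_EFinP/measurable_mixture.
by apply: filterS mixture_ae => x /esym.
Qed.

Lemma mixture_term_le x i A : P x = A%:E -> w i * p i x <= A.
Proof.
move=> PA; rewrite -lee_fin -PA; apply: esum_ge; exists [set i].
  by split.
by rewrite fsbig_set1.
Qed.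

End one_mixture.

(** Convexity of the divergence, pointwise and then integrated. The log-sum
    inequality bounds the integrand at the mixtures by the sum of the
    integrands at the weighted components, Tonelli exchanges sum and integral,
    and the chain rule [kl_gap_scale] splits each resulting term into the part
    of the weights and the part of the components. *)
Lemma KL_mixture_le (w v : I -> R) (p q : I -> T -> R) :
  (forall i, 0 < w i) -> (forall i, 0 < v i) ->
  (\esum_(i in [set: I]) (w i)%:E = 1)%E ->
  (\esum_(i in [set: I]) (v i)%:E = 1)%E ->
  (forall i x, 0 < p i x) -> (forall i x, 0 < q i x) ->
  (forall i, measurable_fun setT (p i)) ->
  (forall i, measurable_fun setT (q i)) ->
  (forall i, \int[mu]_x (p i x)%:E = 1)%E ->
  (forall i, \int[mu]_x (q i x)%:E = 1)%E ->
  (KL mu (mixture w p) (mixture v q) <=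
   KL_weights w v + signed_esum (fun i => (w i)%:E * KL mu (p i) (q i)))%E.
Proof.
move=> w0 v0 w1 v1 p0 q0 mp mq p1 q1.
(* some component is needed for the mixtures to be positive *)
have [i0|noI] := pselect (inhabited I); last first.
  have /eqP : (\esum_(i in [set: I]) (w i)%:E = 0)%E.
    by apply: esum1 => i; case: noI.
  by rewrite w1 onee_eq0.
case: i0 => i0.
have wp0 i x : 0 < w i * p i x by rewrite mulr_gt0.
have vq0 i x : 0 < v i * q i x by rewrite mulr_gt0.
have mwp i : measurable_fun setT (fun x => w i * p i x).
  exact: measurable_funM.
have mvq i : measurable_fun setT (fun x => v i * q i x).
  exact: measurable_funM.
have gap0 i x : (0 <= kl_gap (w i * p i x) (v i * q i x))%E.
  by rewrite kl_gap_ge0// ltW.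
have mgap i : measurable_fun setT (fun x => kl_gap (w i * p i x) (v i * q i x)).
  by apply: measurable_kl_gap => // x; rewrite ltW.
have mgap1 i : measurable_fun setT (fun x => kl_gap (p i x) (q i x)).
  by apply: measurable_kl_gap => // x; rewrite ltW.
have gap10 i x : (0 <= kl_gap (p i x) (q i x))%E by rewrite kl_gap_ge0// ltW.
have KLi i : KL mu (p i) (q i) = (\int[mu]_x kl_gap (p i x) (q i x))%E.
  by apply: KL_gap => // x; rewrite ltW.
have mrho := measurable_mixture w0 p0 mp.
have mtrho := measurable_mixture v0 q0 mq.
have rho0 := mixture_ge0 w0 p0; have trho0 := mixture_ge0 v0 q0.
rewrite (KL_gap mrho mtrho)//;
  [|exact: integral_mixture|exact: integral_mixture].
apply: (@le_trans _ _
    (\int[mu]_x \esum_(i in [set: I]) kl_gap (w i * p i x) (v i * q i x))%E).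
  apply: ae_ge0_le_integral => //.
  - by move=> x _; exact: kl_gap_ge0.
  - exact: measurable_kl_gap.
  - by move=> x _; exact: esum_ge0.
  - exact: measurable_esum.
  apply: filterS2 (mixture_ae w0 p0 w1 mp p1) (mixture_ae v0 q0 v1 mq q1).
  move=> x sp sq _; apply: kl_gap_esum => //.
    exact: lt_le_trans (wp0 i0 x) (mixture_term_le i0 sp).
  exact: lt_le_trans (vq0 i0 x) (mixture_term_le i0 sq).
have wKL0 i : (0 <= (w i)%:E * KL mu (p i) (q i))%E.
  by apply: mule_ge0; [rewrite lee_fin ltW | rewrite KLi integral_ge0].
have gapw0 i : (0 <= kl_gap (w i) (v i))%E by rewrite kl_gap_ge0// ltW.
rewrite integral_esum// KL_weights_gap// signed_esum_ge0// -esumD//.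
apply: le_esum => i _; rewrite KLi.
have mpE (c : R) : measurable_fun setT (fun x => (c * p i x)%:E).
  exact/measurable_EFinP/measurable_funM.
have mqE (c : R) : measurable_fun setT (fun x => (c * q i x)%:E).
  exact/measurable_EFinP/measurable_funM.
have ipc (c : R) : 0 <= c -> (\int[mu]_x (c * p i x)%:E = c%:E)%E.
  by apply: integral_density_scale => // x; rewrite ltW.
have iqc (c : R) : 0 <= c -> (\int[mu]_x (c * q i x)%:E = c%:E)%E.
  by apply: integral_density_scale => // x; rewrite ltW.
pose g := fine (kl_gap (w i) (v i)).
have gE : (g%:E = kl_gap (w i) (v i))%E by rewrite /g /kl_gap !gt_eqF.
have g0 : 0 <= g by rewrite -lee_fin gE kl_gap_ge0// ltW.
have E : (\int[mu]_x (kl_gap (w i * p i x) (v i * q i x)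
      + (v i * p i x)%:E + (w i * q i x)%:E) =
    \int[mu]_x ((w i)%:E * kl_gap (p i x) (q i x) + (g * p i x)%:E
      + (w i * p i x)%:E + (v i * q i x)%:E))%E.
  apply: eq_integral => x _; rewrite kl_gap_scale// -gE -EFinM.
  by rewrite [g * _]mulrC.
have mgw : measurable_fun setT (fun x => (w i)%:E * kl_gap (p i x) (q i x))%E.
  exact: measurable_funeM.
have Fge0 (c s : R) : 0 <= c -> 0 < s -> (0 <= (c * s)%:E)%E.
  by move=> c0 s0; rewrite lee_fin mulr_ge0// ltW.
move: E; rewrite !ge0_integralD//=; try by
  (move=> *; rewrite ?adde_ge0 ?mule_ge0 ?Fge0 ?lee_fin// ltW) ||
  (repeat apply: emeasurable_funD => //).
have [wi0 vi0] := (ltW (w0 i), ltW (v0 i)).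
rewrite !ipc// !iqc// ge0_integralZl_EFin// -gE.
exact: le_of_balance.
Qed.

End mixtures.

(** * Positive definite quadratic forms *)

Section positive_definite.
Variable R : realType.

Definition quad n (P : 'M[R]_n) (y : 'rV[R]_n) : R := (y *m P *m y^T) 0 0.

Definition posdef n (P : 'M[R]_n) : Prop :=
  P^T = P /\ forall v : 'rV[R]_n, v != 0 -> 0 < quad P v.

Lemma quad_congr n k (P : 'M[R]_n) (U : 'M[R]_(k, n)) (y : 'rV[R]_k) :
  quad (U *m P *m U^T) y = quad P (y *m U).
Proof. by rewrite /quad trmx_mul !mulmxA. Qed.

(** Completing the square in the first variable. With P = [a, b; b^T, D] one
    has P = U diag(a, S) U^T for U = [1, 0; c, 1], where c = b^T / a and S is
    the Schur complement D - b^T b / a. This reduces determinants and Gaussian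
    integrals of a positive definite form to one variable and one dimension
    less. *)
Lemma posdef_complete_square n (P : 'M[R]_(1 + n)) : posdef P ->
  exists a (c : 'cV[R]_n) (S : 'M[R]_n),
    [/\ 0 < a, posdef S, \det P = a * \det S &
        forall y0 y, quad P (row_mx y0%:M y) =
          a * (y0 + (y *m c) 0 0) ^+ 2 + quad S y].
Proof.
move=> [symP posP].
pose a := ulsubmx P 0 0; pose b := ursubmx P.
pose c : 'cV[R]_n := a^-1 *: b^T.
pose S := drsubmx P - a *: (c *m c^T).
pose U : 'M[R]_(1 + n) := block_mx 1%:M 0 c 1%:M.
have ulP : ulsubmx P = a%:M by rewrite [LHS]mx11_scalar.
have dlP : dlsubmx P = b^T by rewrite /b trmx_ursub symP.
have symD : (drsubmx P)^T = drsubmx P by rewrite trmx_drsub symP.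
have quad0 (x : R) (y : 'rV[R]_n) :
    quad (block_mx a%:M 0 0 S) (row_mx x%:M y) = a * x ^+ 2 + quad S y.
  rewrite /quad mul_row_block !mulmx0 addr0 add0r tr_row_mx mul_row_col mxE.
  by rewrite tr_scalar_mx -!scalar_mxM mxE eqxx mulr1n; congr (_ + _); ring.
have a0 : 0 < a.
  have := posP (row_mx 1%:M 0).
  rewrite -[P]submxK ulP /quad mul_row_block !mul0mx !addr0 mul1mx tr_row_mx.
  rewrite mul_row_col trmx0 mulmx0 addr0 tr_scalar_mx mulmx1 mxE eqxx mulr1n.
  apply; apply/eqP => /(congr1 lsubmx); rewrite row_mxKl linear0.
  by move/matrixP/(_ 0 0)/eqP; rewrite !mxE eqxx oner_eq0.
have PE : P = U *m block_mx a%:M 0 0 S *m U^T.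
  rewrite /U tr_block_mx !mulmx_block !trmx1 !trmx0.
  rewrite !mul1mx !mul0mx !mulmx1 !mulmx0 !addr0 !add0r.
  rewrite -[LHS]submxK ulP dlP -/b.
  have -> : c *m a%:M = b^T.
    by rewrite mul_mx_scalar scalerA divff ?gt_eqF// scale1r.
  congr block_mx.
    rewrite mul_scalar_mx /c linearZ/= trmxK scalerA divff ?gt_eqF//.
    by rewrite scale1r.
  rewrite /S scalemxAl [a *: c]scalerA divff ?gt_eqF// scale1r.
  by rewrite addrC subrK.
have quadP x y :
    quad P (row_mx x%:M y) = a * (x + (y *m c) 0 0) ^+ 2 + quad S y.
  rewrite {1}PE quad_congr /U mul_row_block mulmx1 mulmx0 add0r mulmx1.
  have -> : x%:M + y *m c = (x + (y *m c) 0 0)%:M.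
    by apply/matrixP => i j; rewrite !ord1 [LHS]mxE !mxE eqxx !mulr1n.
  by rewrite quad0.
exists a, c, S; split => //.
  split.
    by rewrite /S linearB/= symD linearZ/= trmx_mul trmxK.
  (* completing v by the minimizing first coordinate kills the square *)
  move=> v v0; have := quadP (- (v *m c) 0 0) v.
  rewrite addNr expr0n/= mulr0 add0r => <-; apply: posP.
  apply: contra_neq v0 => /(congr1 rsubmx).
  by rewrite row_mxKr linear0.
rewrite {1}PE !det_mulmx det_tr /U det_lblock !det1 det_ublock det_scalar1.
by rewrite !mul1r mulr1.
Qed.

End positive_definite.

Section positive_definite_inverse.
Variable R : realType.

Lemma posdef_det_gt0 n (P : 'M[R]_n) : posdef P -> 0 < \det P.
Proof.
elim: n P => [|n IHn] P; first by rewrite det_mx00 ltr01.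
move=> /(@posdef_complete_square R n)[a [c [S [a0 pS -> _]]]].
by rewrite mulr_gt0// IHn.
Qed.

Lemma posdef_invmx n (P : 'M[R]_n) : posdef P -> posdef (invmx P).
Proof.
move=> pP; have uP : P \in unitmx.
  by rewrite unitmxE unitfE gt_eqF// posdef_det_gt0.
case: pP => symP posP.
have symV : (invmx P)^T = invmx P by rewrite trmx_inv symP.
split=> // v v0; have -> : quad (invmx P) v = quad P (v *m invmx P).
  by rewrite /quad trmx_mul symV mulmxA mulmxKV.
apply: posP; apply: contra_neq v0 => /(congr1 (mulmx^~ P)).
by rewrite mulmxKV// mul0mx.
Qed.

End positive_definite_inverse.

(** * Gaussian integrals *)

Section normal_density.
Variable R : realType.
Implicit Types m t x : R.
Local Notation mu := (@lebesgue_measure R).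

(** The density of N(m, t) parametrized by the variance t, as in
    [gaussian_pdf]; [normal_pdf] takes the standard deviation. *)
Definition npdf m t x : R :=
  expR (- ((x - m) ^+ 2 / t) / 2) / Num.sqrt (2 * pi * t).

Lemma npdf_normal_pdf m t : 0 < t -> npdf m t = normal_pdf m (Num.sqrt t).
Proof.
move=> t0; have st0 : Num.sqrt t != 0 by rewrite gt_eqF// sqrtr_gt0.
apply/funext => x; rewrite normal_pdfE// /npdf /normal_peak /normal_fun.
rewrite sqr_sqrtr ?ltW// mulrC; congr (_^-1 * expR _).
  by congr Num.sqrt; ring.
by field; rewrite gt_eqF.
Qed.

Lemma npdf_gt0 m t x : 0 < t -> 0 < npdf m t x.
Proof.
move=> t0; rewrite divr_gt0 ?expR_gt0// sqrtr_gt0.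
by rewrite !mulr_gt0// pi_gt0.
Qed.

Lemma measurable_npdf m t : 0 < t -> measurable_fun setT (npdf m t).
Proof.
by move=> t0; rewrite npdf_normal_pdf//; exact: measurable_normal_pdf.
Qed.

Lemma integral_npdf m t : 0 < t -> (\int[mu]_x (npdf m t x)%:E = 1)%E.
Proof. by move=> t0; rewrite npdf_normal_pdf// integral_normal_pdf. Qed.

Lemma integral_expR_sqr a m : 0 < a ->
  (\int[mu]_x (expR (- (a * (x - m) ^+ 2) / 2))%:E =
   (Num.sqrt (2 * pi / a))%:E)%E.
Proof.
move=> a0; have t0 : 0 < a^-1 by rewrite invr_gt0.
have s0 : Num.sqrt (2 * pi / a) != 0.
  by rewrite gt_eqF// sqrtr_gt0 !mulr_gt0 ?pi_gt0.
transitivity (\int[mu]_x ((Num.sqrt (2 * pi / a))%:E * (npdf m a^-1 x)%:E))%E.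
  apply: eq_integral => x _; rewrite -EFinM /npdf invrK; congr EFin.
  by rewrite [RHS]mulrCA divff// mulr1 [a * _]mulrC.
rewrite ge0_integralZl_EFin ?integral_npdf ?mule1//.
- by move=> x _; rewrite lee_fin ltW// npdf_gt0.
- by apply/measurable_EFinP; exact: measurable_npdf.
Qed.

End normal_density.

Section lebesgue_Rn_integrals.
Variable R : realType.

Lemma integral_lebesgue_Rn_0 (f : Rn R 0 -> \bar R) :
  measurable_fun setT f ->
  (\int[lebesgue_Rn R 0]_x f x = f [tuple])%E.
Proof. by move=> mf; rewrite /= integral_dirac//= diracT mul1e. Qed.

Lemma integral_lebesgue_Rn_S n (f : Rn R n.+1 -> \bar R) :
  measurable_fun setT f -> (forall x, 0 <= f x)%E ->
  (\int[lebesgue_Rn R n.+1]_x f x =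
   \int[lebesgue_Rn R n]_y \int[@lebesgue_measure R]_a f (cons_pair (a, y)))%E.
Proof.
move=> mf f0.
have mcons := @measurable_cons_pair R n.
rewrite [LHS](ge0_integral_pushforward mcons)//= preimage_setT.
by rewrite fubini_tonelli2//; exact: measurableT_comp.
Qed.

Lemma measurable_quad n (P : 'M[R]_n) (m : 'rV[R]_n) :
  measurable_fun setT (fun x : Rn R n => quad P (rv_of x - m)).
Proof.
rewrite (_ : (fun _ => _) = (fun x : Rn R n => \sum_j
    (\sum_i (tnth x i - m 0 i) * P i j) * (tnth x j - m 0 j))); last first.
  apply/funext => x; rewrite /quad mxE; apply: eq_bigr => j _.
  rewrite !mxE; congr (_ * _); apply: eq_bigr => i _.
  by rewrite !mxE.
have mx j : measurable_fun setT (fun x : Rn R n => tnth x j - m 0 j).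
  apply: measurable_funB => //; exact: measurable_tnth.
apply: measurable_sum => j; apply: measurable_funM => //.
by apply: measurable_sum => i; exact: measurable_funM.
Qed.

Lemma rv_of_cons n a (y : Rn R n) (m : 'rV[R]_(1 + n)) :
  rv_of (cons_pair (a, y)) - m =
  row_mx (a - m 0 0)%:M (rv_of y - rsubmx m) :> 'rV[R]_(1 + n).
Proof.
apply/rowP => i; case: (split_ordP i) => j ->.
  rewrite row_mxEl !mxE ord1 eqxx mulr1n; congr (_ - m _ _).
  exact: val_inj.
rewrite row_mxEr !mxE; congr (_ - _).
have -> : rshift 1 j = lift ord0 j by exact: val_inj.
by rewrite tnthS.
Qed.

(** No linear change of variables is needed: by induction on the dimension,
    [posdef_complete_square] makes the inner integral over the first coordinate
    a one-dimensional Gaussian with a shifted centre, whose value sqrt(2 pi / a)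
    does not depend on the other coordinates. *)
Lemma integral_gaussian_Rn n (P : 'M[R]_n) (m : 'rV[R]_n) : posdef P ->
  (\int[lebesgue_Rn R n]_x (expR (- quad P (rv_of x - m) / 2))%:E =
   (Num.sqrt ((2 * pi) ^+ n / \det P))%:E)%E.
Proof.
elim: n P m => [|n IHn] P m pP.
  rewrite integral_lebesgue_Rn_0 => [|].
    rewrite det_mx00 expr0 divr1 sqrtr1.
    by rewrite /quad mxE big_ord0 oppr0 mul0r expR0.
  apply/measurable_EFinP/measurableT_comp => //.
  apply: measurable_funM => //; apply: measurableT_comp => //.
  exact: measurable_quad.
rewrite integral_lebesgue_Rn_S; first last.
- by move=> x; rewrite lee_fin expR_ge0.
- apply/measurable_EFinP/measurableT_comp => //.
  apply: measurable_funM => //; apply: measurableT_comp => //.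
  exact: measurable_quad.
have [a [c [S [a0 pS detP quadP]]]] := @posdef_complete_square R n P pP.
pose m' := rsubmx (m : 'rV_(1 + n)).
have E (y : Rn R n) (x : R) : quad P (rv_of (cons_pair (x, y)) - m) =
    a * (x - (m 0 0 - ((rv_of y - m') *m c) 0 0)) ^+ 2 + quad S (rv_of y - m').
  by rewrite rv_of_cons quadP -/m' opprB addrA [in RHS]addrAC.
have inner (y : Rn R n) : (\int[@lebesgue_measure R]_x
      (expR (- quad P (rv_of (cons_pair (x, y)) - m) / 2))%:E =
    (Num.sqrt (2 * pi / a))%:E * (expR (- quad S (rv_of y - m') / 2))%:E)%E.
  rewrite -(integral_expR_sqr (m 0 0 - ((rv_of y - m') *m c) 0 0) a0).
  rewrite -ge0_integralZr//.
  - by apply: eq_integral => x _; rewrite E opprD mulrDl expRD EFinM.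
  - apply/measurable_EFinP/measurableT_comp => //.
    apply: measurable_funM => //; apply: measurableT_comp => //.
    apply: measurable_funM => //; apply: measurable_funX.
    exact: measurable_funB.
transitivity (\int[lebesgue_Rn R n]_y ((Num.sqrt (2 * pi / a))%:E *
    (expR (- quad S (rv_of y - m') / 2))%:E))%E.
  by apply: eq_integral => y _; exact: inner.
rewrite ge0_integralZl_EFin//; last first.
  apply/measurable_EFinP/measurableT_comp => //.
  apply: measurable_funM => //; apply: measurableT_comp => //.
  exact: measurable_quad.
rewrite IHn// -EFinM detP -sqrtrM; last first.
  by rewrite divr_ge0// ?mulr_ge0 ?pi_ge0// ltW.
congr (Num.sqrt _)%:E; rewrite exprS; field.
by rewrite !gt_eqF// posdef_det_gt0.
Qed.

End lebesgue_Rn_integrals.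

Section gaussian_densities.
Variables (R : realType) (n : nat).
Implicit Types (m s : 'rV[R]_n) (S : 'M[R]_n).

Lemma quad_diag s y : quad (diag_mx s) y = \sum_j s 0 j * y 0 j ^+ 2.
Proof.
rewrite /quad mul_mx_diag mxE; apply: eq_bigr => j _.
by rewrite !mxE; ring.
Qed.

Lemma posdef_diag s : (forall j, 0 < s 0 j) -> posdef (diag_mx s).
Proof.
move=> s0; split; first exact: tr_diag_mx.
move=> v v0; rewrite quad_diag.
have sv0 j : 0 <= s 0 j * v 0 j ^+ 2 by rewrite mulr_ge0 ?sqr_ge0 ?ltW.
rewrite lt0r sumr_ge0// andbT; apply: contra_neq v0 => /eqP.
rewrite psumr_eq0// => /allP h; apply/rowP => j.
have := h j (mem_index_enum j); rewrite mulf_eq0 gt_eqF//= sqrf_eq0 => /eqP ->.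
by rewrite mxE.
Qed.

Lemma posdef_covarianceD S S' : is_covariance S -> posdef S' -> posdef (S + S').
Proof.
move=> [symS S0] [symS' S'0]; split; first by rewrite linearD/= symS symS'.
move=> v v0; rewrite /quad mulmxDr mulmxDl mxE.
by apply: ltr_wpDl; [exact: S0 | exact: S'0].
Qed.

Lemma measurable_gaussian_pdf m S : measurable_fun setT (gaussian_pdf m S).
Proof.
apply: measurable_funM => //; apply: measurableT_comp => //.
apply: measurable_funM => //; apply: measurableT_comp => //.
exact: measurable_quad.
Qed.

Lemma gaussian_pdf_gt0 m S x : posdef S -> 0 < gaussian_pdf m S x.
Proof.
move=> pS; rewrite divr_gt0 ?expR_gt0// sqrtr_gt0.
by rewrite mulr_gt0 ?posdef_det_gt0// exprn_gt0// mulr_gt0// pi_gt0.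
Qed.

Lemma integral_gaussian_pdf m S : posdef S ->
  (\int[lebesgue_Rn R n]_x (gaussian_pdf m S x)%:E = 1)%E.
Proof.
move=> pS; set c := Num.sqrt ((2 * pi) ^+ n * \det S).
have c0 : 0 < c.
  by rewrite sqrtr_gt0 mulr_gt0 ?posdef_det_gt0// exprn_gt0// mulr_gt0// pi_gt0.
transitivity (\int[lebesgue_Rn R n]_x
    ((c^-1)%:E * (expR (- quad (invmx S) (rv_of x - m) / 2))%:E))%E.
  by apply: eq_integral => x _; rewrite -EFinM mulrC.
rewrite ge0_integralZl_EFin ?invr_ge0 ?(ltW c0)//; last first.
  apply/measurable_EFinP/measurableT_comp => //.
  apply: measurable_funM => //; apply: measurableT_comp => //.
  exact: measurable_quad.
rewrite integral_gaussian_Rn; last exact: posdef_invmx.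
by rewrite det_inv invrK -EFinM mulVf// gt_eqF.
Qed.

Lemma gaussian_pdf_diag m s x : (forall j, 0 < s 0 j) ->
  gaussian_pdf m (diag_mx s) x = \prod_j npdf (m 0 j) (s 0 j) (tnth x j).
Proof.
move=> s0; rewrite /gaussian_pdf -/(quad _ _).
have -> : invmx (diag_mx s) = diag_mx (\row_j (s 0 j)^-1).
  have u : diag_mx s \in unitmx.
    by rewrite unitmxE unitfE gt_eqF// posdef_det_gt0//; exact: posdef_diag.
  apply: (can_inj (mulKmx u)); rewrite mulmxV// mulmx_diag.
  apply/matrixP => i j; rewrite !mxE; case: eqVneq => //= _.
  by rewrite divff// gt_eqF.
rewrite quad_diag det_diag.
rewrite /npdf big_split/= -expR_sum prodfV.
congr (expR _ / _).
  rewrite mulNr mulr_suml -sumrN; apply: eq_bigr => j _; rewrite !mxE.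
  by rewrite [_^-1 * _]mulrC mulNr.
rewrite -[(2 * pi) ^+ n](_ : \prod_(j < n) (2 * pi) = _); last first.
  by rewrite prodr_const card_ord.
rewrite -big_split/=; elim/big_rec2: _ => [|j a b _ <-].
  by rewrite sqrtr1.
by rewrite sqrtrM// !mulr_ge0 ?pi_ge0 ?ltW.
Qed.

End gaussian_densities.

(** * Moments of one-dimensional Gaussians *)

Section has_int.
Context d (T : measurableType d) (R : realType).
Variable mu : {measure set T -> \bar R}.
Implicit Types (f g : T -> R) (a b : R).

(** Bundles integrability with the value of the integral, so that real-valued
    integrands of arbitrary sign can be combined linearly. *)
Definition has_int f a : Prop :=
  mu.-integrable setT (EFin \o f) /\ (\int[mu]_x (f x)%:E = a%:E)%E.

Lemma ge0_has_int f a : measurable_fun setT f -> (forall x, 0 <= f x) ->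
  (\int[mu]_x (f x)%:E = a%:E)%E -> has_int f a.
Proof.
move=> mf f0 fa; split=> //; apply/integrableP.
split; first exact/measurable_EFinP.
under eq_integral do rewrite gee0_abs ?lee_fin//.
by rewrite fa ltry.
Qed.

Lemma has_intD f g a b : has_int f a -> has_int g b ->
  has_int (fun x => f x + g x) (a + b).
Proof.
move=> [intf fa] [intg gb]; split.
  exact: (integrableD measurableT intf intg).
by under eq_integral do rewrite EFinD; rewrite integralD// fa gb.
Qed.

Lemma has_intZ k f a : has_int f a -> has_int (fun x => k * f x) (k * a).
Proof.
move=> [intf fa]; split; first exact: (integrableZl measurableT k intf).
by under eq_integral do rewrite EFinM; rewrite integralZl// fa.
Qed.

Lemma has_int_sum n (f : 'I_n -> T -> R) (a : 'I_n -> R) :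
  (forall j, has_int (f j) (a j)) ->
  has_int (fun x => \sum_j f j x) (\sum_j a j).
Proof.
move=> fa; have int0 : has_int (fun=> 0) 0.
  by split; [exact: integrable0 | rewrite integral0].
elim: n f a fa => [|n IHn] f a fa.
  rewrite big_ord0; under [X in has_int X]eq_fun do rewrite big_ord0.
  exact: int0.
rewrite big_ord_recl; under [X in has_int X]eq_fun do rewrite big_ord_recl.
by apply: has_intD => //; exact: IHn.
Qed.

Lemma le_has_int f g a b : has_int f a -> has_int g b ->
  (forall x, f x <= g x) -> a <= b.
Proof.
move=> [intf fa] [intg gb] fg; rewrite -lee_fin -fa -gb.
by apply: le_integral => // x _; rewrite lee_fin.
Qed.

Lemma dominated_has_int f g b : measurable_fun setT f -> has_int g b ->
  (forall x, `|f x| <= g x) -> exists a, has_int f a.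
Proof.
move=> mf [intg _] fg.
have intf : mu.-integrable setT (EFin \o f).
  apply: le_integrable intg => //; first exact/measurable_EFinP.
  by move=> x _ /=; rewrite lee_fin (le_trans (fg x))// ler_norm.
exists (fine (\int[mu]_x (f x)%:E)); split=> //.
by rewrite fineK//; exact: integrable_fin_num.
Qed.

End has_int.

Section normal_moments.
Variable R : realType.
Implicit Types m t x : R.
Local Notation mu := (@lebesgue_measure R).

Lemma has_int_npdf m t : 0 < t -> has_int mu (npdf m t) 1.
Proof.
move=> t0; apply: ge0_has_int; first exact: measurable_npdf.
  by move=> x; rewrite ltW// npdf_gt0.
exact: integral_npdf.
Qed.

(** Multiplying a centred Gaussian by the exponential of a multiple of
    (x - m)^2 changes its variance, here by the factor y^-2, and its mass by
    y^-1. *)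
Lemma npdf_scale m t y x : 0 < t -> 0 < y ->
  npdf m t x * expR ((1 - y ^+ 2) / (2 * t) * (x - m) ^+ 2) =
  y^-1 * npdf m (t / y ^+ 2) x.
Proof.
move=> t0 y0; rewrite /npdf mulrAC -expRD.
have -> : Num.sqrt (2 * pi * (t / y ^+ 2)) = Num.sqrt (2 * pi * t) / y.
  rewrite mulrA sqrtrM ?mulr_ge0 ?pi_ge0 ?(ltW t0)//.
  by rewrite sqrtrV ?sqr_ge0// sqrtr_sqr gtr0_norm.
have s0 : Num.sqrt (2 * pi * t) != 0.
  by rewrite gt_eqF// sqrtr_gt0 !mulr_gt0// pi_gt0.
rewrite [RHS](_ : _ = expR (- ((x - m) ^+ 2 / (t / y ^+ 2)) / 2) /
    Num.sqrt (2 * pi * t)); last by field; rewrite s0 gt_eqF.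
by congr (expR _ / _); field; rewrite !gt_eqF.
Qed.

(** Exponential tilting moves the centre of a Gaussian; the factor is its
    moment generating function. *)
Lemma npdf_shift m t h x : 0 < t ->
  npdf m t x * expR (h * (x - m)) =
  expR (h ^+ 2 * t / 2) * npdf (m + h * t) t x.
Proof.
move=> t0; rewrite /npdf mulrAC -expRD mulrA -expRD; congr (expR _ / _).
by field; rewrite !gt_eqF.
Qed.

(** The second moment M is pinched between Gaussian masses at nearby scales.
    Integrating 1 + u <= exp u at u = (1 - y^2) (x - m)^2 / (2 t), where
    [npdf_scale] gives the right-hand side 1 / y, yields
    (1 - y^2) y M <= 2 t (1 - y) for all y > 0. Dividing by 1 - y bounds M by
    2 t / (y (1 + y)) from above for y < 1 and from below for y > 1, and both
    bounds tend to t as y tends to 1. *)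
Lemma npdf_moment2 m t : 0 < t ->
  has_int mu (fun x => npdf m t x * (x - m) ^+ 2) t.
Proof.
move=> t0; have p0 x := npdf_gt0 m x t0.
have scaled y : 0 < y ->
    has_int mu (fun x => npdf m t x *
        expR ((1 - y ^+ 2) / (2 * t) * (x - m) ^+ 2)) y^-1.
  move=> y0; rewrite [X in has_int _ X _](_ : _ =
      fun x => y^-1 * npdf m (t / y ^+ 2) x).
    rewrite -[X in has_int _ _ X]mulr1; apply/has_intZ/has_int_npdf.
    by rewrite divr_gt0 ?exprn_gt0.
  by apply/funext => x; exact: npdf_scale.
have mf : measurable_fun setT (fun x => npdf m t x * (x - m) ^+ 2).
  apply: measurable_funM; first exact: measurable_npdf.
  by apply: measurable_funX; exact: measurable_funB.
have [M intM] : exists M, has_int mu (fun x => npdf m t x * (x - m) ^+ 2) M.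
  (* at y = 1 / 2 the exponent is 3 (x - m)^2 / (8 t), whose exponential
     dominates it *)
  have /(has_intZ (8 * t / 3)) dom := scaled 2^-1 ltac:(by rewrite invr_gt0).
  apply: (@dominated_has_int _ (measurableTypeR R) _ mu _ _ _ mf dom) => x.
  rewrite ger0_norm; last by rewrite mulr_ge0 ?sqr_ge0// ltW.
  rewrite [leRHS]mulrCA ler_pM2l//.
  set c := (1 - _) / _.
  have c0 : 0 < 8 * t / 3 by rewrite !mulr_gt0.
  rewrite -ler_pdivrMl//.
  have -> : (8 * t / 3)^-1 = c by rewrite /c; field; rewrite gt_eqF.
  by apply: le_trans (expR_ge1Dx _); rewrite lerDr.
have pinch y : 0 < y -> 1 + (1 - y ^+ 2) / (2 * t) * M <= y^-1.
  move=> y0; apply: le_has_int (has_intD (has_int_npdf m t0)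
    (has_intZ ((1 - y ^+ 2) / (2 * t)) intM)) (scaled y y0) _ => x.
  rewrite mulrCA -{1}[npdf m t x]mulr1 -mulrDr ler_pM2l//.
  exact: expR_ge1Dx.
have pinch' y : 0 < y -> (1 - y ^+ 2) * (M * y) <= 2 * t * (1 - y).
  move=> y0; have := pinch y y0.
  rewrite -(ler_pM2r (mulr_gt0 (mulr_gt0 (ltr0Sn R 1) t0) y0)).
  rewrite [X in X <= _ -> _](_ : _ =
      2 * t * y + (1 - y ^+ 2) * (M * y)); last by field; rewrite gt_eqF.
  rewrite [X in _ <= X -> _](_ : _ = 2 * t); last by field; rewrite gt_eqF.
  by lra.
suff e : M = t by rewrite -[X in has_int _ _ X]e.
apply/eqP; rewrite eq_le; apply/andP; split; rewrite leNgt; apply/negP => ltM.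
  have M0 : 0 < M by apply: lt_trans ltM.
  (* y = 1 - e with e small enough that the bound at y contradicts t < M *)
  pose e := (M - t) / (2 * M).
  have eM : e * (2 * M) = M - t by rewrite /e divfK// gt_eqF ?mulr_gt0.
  have e0 : 0 < e by rewrite divr_gt0 ?subr_gt0 ?mulr_gt0.
  have e1 : e < 1 by rewrite ltr_pdivrMr ?mulr_gt0//; lra.
  have /pinch' : 0 < 1 - e by lra.
  rewrite (_ : (1 - _) * _ = e * ((2 - e) * (1 - e) * M)); last by ring.
  rewrite (_ : 2 * t * _ = e * (2 * t)); last by ring.
  rewrite ler_pM2l//; have : 0 <= e * e * M.
    by apply: mulr_ge0 (ltW M0); apply: mulr_ge0; exact: ltW.
  by lra.
have M0 : 0 <= M.
  have int0 : has_int mu (fun=> 0) 0.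
    by split; [exact: integrable0 | rewrite integral0].
  by apply: le_has_int int0 intM _ => x; rewrite mulr_ge0 ?sqr_ge0// ltW.
(* symmetrically, y = 1 + e contradicts M < t *)
pose e := (t - M) / (4 * t).
have et : e * (4 * t) = t - M by rewrite /e divfK// gt_eqF ?mulr_gt0.
have e0 : 0 < e by rewrite divr_gt0 ?subr_gt0 ?mulr_gt0.
have e1 : e < 1 by rewrite ltr_pdivrMr ?mulr_gt0//; lra.
have /pinch' : 0 < 1 + e by lra.
rewrite (_ : (1 - _) * _ = - (e * ((2 + e) * (1 + e) * M))); last by ring.
rewrite (_ : 2 * t * _ = - (e * (2 * t))); last by ring.
rewrite lerN2 ler_pM2l//.
have : e * e * M <= e * M by rewrite ler_wpM2r// ger_pMr// ltW.
have : e * M < e * t by rewrite ltr_pM2l.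
by lra.
Qed.

(** Integrating 1 + u <= exp u at u = h (x - m) gives
    1 + h E <= exp (h^2 t / 2) for every h. To first order in h the right-hand
    side is 1, so a nonzero E is excluded by a small h of the same sign. *)
Lemma npdf_moment1 m t : 0 < t ->
  has_int mu (fun x => npdf m t x * (x - m)) 0.
Proof.
move=> t0; have p0 x := npdf_gt0 m x t0.
have mf : measurable_fun setT (fun x => npdf m t x * (x - m)).
  apply: measurable_funM; first exact: measurable_npdf.
  exact: measurable_funB.
have [E intE] : exists E, has_int mu (fun x => npdf m t x * (x - m)) E.
  apply: (@dominated_has_int _ (measurableTypeR R) _ mu _ _ _ mf
    (has_intD (has_int_npdf m t0) (npdf_moment2 m t0))) => x.
  rewrite normrM gtr0_norm// -{2}[npdf m t x]mulr1 -mulrDr ler_pM2l//.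
  set z := x - m; have := sqr_ge0 (z - 2^-1); have := sqr_ge0 (z + 2^-1).
  by rewrite !expr2 ler_norml => *; apply/andP; split; lra.
have pinch h : 1 + h * E <= expR (h ^+ 2 * t / 2).
  have shifted : has_int mu (fun x => npdf m t x * expR (h * (x - m)))
      (expR (h ^+ 2 * t / 2)).
    rewrite [X in has_int _ X _](_ : _ =
        fun x => expR (h ^+ 2 * t / 2) * npdf (m + h * t) t x).
      by rewrite -[X in has_int _ _ X]mulr1; apply/has_intZ/has_int_npdf.
    by apply/funext => x; exact: npdf_shift.
  apply: le_has_int (has_intD (has_int_npdf m t0) (has_intZ h intE))
    shifted _ => x.
  rewrite mulrCA -{1}[npdf m t x]mulr1 -mulrDr ler_pM2l//.
  exact: expR_ge1Dx.
suff e : E = 0 by rewrite -[X in has_int _ _ X]e.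
apply/eqP/negPn/negP => E0.
have EE0 : 0 < E ^+ 2 by rewrite exprn_even_gt0.
have s0 : 0 < t + E ^+ 2 by rewrite addr_gt0.
(* h = E / (t + E^2) gives h E = v < 1 and h^2 t / 2 <= v / 2, and
   1 + v <= exp (v / 2) fails for 0 < v < 1 *)
pose v := E ^+ 2 / (t + E ^+ 2).
have v0 : 0 < v by rewrite divr_gt0.
have v1 : v < 1 by rewrite ltr_pdivrMr// mul1r; lra.
have := pinch (E / (t + E ^+ 2)).
rewrite (_ : _ * E = v); last by rewrite /v; ring.
have le2 : (E / (t + E ^+ 2)) ^+ 2 * t / 2 <= v / 2.
  rewrite ler_pM2r ?invr_gt0// (_ : _ * t = v * (t / (t + E ^+ 2))); last first.
    by rewrite /v; field; rewrite gt_eqF.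
  by rewrite ger_pMr// ler_pdivrMr// mul1r; lra.
move=> le1; have {}le1 : 1 + v <= expR (v / 2).
  by apply: le_trans le1 _; rewrite ler_expR.
have le3 : 1 - v / 2 <= expR (- (v / 2)) := expR_ge1Dx _.
have : (1 + v) * (1 - v / 2) <= 1.
  rewrite -[leRHS](expRxMexpNx_1 (v / 2)) ler_pM//; lra.
by nra.
Qed.

Lemma npdf_moment2_center m t c : 0 < t ->
  has_int mu (fun x => npdf m t x * (x - c) ^+ 2) (t + (m - c) ^+ 2).
Proof.
move=> t0; have := has_intD (has_intD (npdf_moment2 m t0)
  (has_intZ (2 * (m - c)) (npdf_moment1 m t0)))
  (has_intZ ((m - c) ^+ 2) (has_int_npdf m t0)).
rewrite mulr0 addr0 mulr1; congr has_int.
by apply/funext => x; ring.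
Qed.

End normal_moments.

(** * Divergence between Gaussians with diagonal covariances *)

Section product_integrals.
Variable R : realType.

Lemma integral_prod_Rn n (h : 'I_n -> R -> R) (c : 'I_n -> R) :
  (forall j, measurable_fun setT (h j)) -> (forall j x, 0 <= h j x) ->
  (forall j, \int[@lebesgue_measure R]_x (h j x)%:E = (c j)%:E)%E ->
  (\int[lebesgue_Rn R n]_x (\prod_j h j (tnth x j))%:E = (\prod_j c j)%:E)%E.
Proof.
elim: n h c => [|n IHn] h c mh h0 hc.
  rewrite integral_lebesgue_Rn_0; first by rewrite !big_ord0.
  under eq_fun do rewrite big_ord0.
  exact: measurable_cst.
have c0 j : 0 <= c j.
  by rewrite -lee_fin -hc integral_ge0// => x _; rewrite lee_fin.
have mprod k (h' : 'I_k -> R -> R) : (forall j, measurable_fun setT (h' j)) ->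
    measurable_fun setT (fun x : Rn R k => (\prod_j h' j (tnth x j))%:E).
  move=> mh'; apply/measurable_EFinP/measurable_prod => j _.
  exact: (measurableT_comp (mh' j) (measurable_tnth j)).
rewrite integral_lebesgue_Rn_S//; [|exact: mprod|].
  transitivity (\int[lebesgue_Rn R n]_y
      ((c ord0)%:E * (\prod_j h (lift ord0 j) (tnth y j))%:E))%E.
    apply: eq_integral => y _.
    rewrite -hc -ge0_integralZr//.
    - apply: eq_integral => a _; rewrite -EFinM big_ord_recl tnth0.
      by congr (_ * _)%:E; apply: eq_bigr => j _; rewrite tnthS.
    - by apply/measurable_EFinP; exact: mh.
    - by move=> a _; rewrite lee_fin.
    - by rewrite lee_fin prodr_ge0.
  rewrite ge0_integralZl_EFin//.
  - rewrite (IHn (fun j => h (lift ord0 j)) (fun j => c (lift ord0 j)))//.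
    by rewrite big_ord_recl.
  - by move=> y _; rewrite lee_fin prodr_ge0.
  - exact: (mprod _ (fun j => h (lift ord0 j))).
by move=> x; rewrite lee_fin prodr_ge0.
Qed.

(** The k-th marginal of a Gaussian with diagonal covariance: the density is a
    product, and all the factors but the k-th integrate to 1. *)
Lemma gaussian_pdf_marginal n (m s : 'rV[R]_n) (g : R -> R) k a :
  (forall j, 0 < s 0 j) -> measurable_fun setT g -> (forall x, 0 <= g x) ->
  has_int (@lebesgue_measure R) (fun x => npdf (m 0 k) (s 0 k) x * g x) a ->
  has_int (lebesgue_Rn R n)
    (fun x => gaussian_pdf m (diag_mx s) x * g (tnth x k)) a.
Proof.
move=> s0 mg g0 [_ ga].
have p0 j x : 0 < npdf (m 0 j) (s 0 j) x by exact: npdf_gt0.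
have mp j : measurable_fun setT (npdf (m 0 j) (s 0 j)).
  exact: measurable_npdf.
pose h j x := npdf (m 0 j) (s 0 j) x * (if j == k then g x else 1).
pose c j : R := if j == k then a else 1.
have hE (x : Rn R n) :
    gaussian_pdf m (diag_mx s) x * g (tnth x k) = \prod_j h j (tnth x j).
  rewrite gaussian_pdf_diag// /h [RHS]big_split/=; congr (_ * _).
  by rewrite -big_mkcond/= big_pred1_eq.
apply: ge0_has_int.
- apply: measurable_funM; first exact: measurable_gaussian_pdf.
  exact: (measurableT_comp mg (measurable_tnth k)).
- move=> x; rewrite mulr_ge0// ltW// gaussian_pdf_gt0//; exact: posdef_diag.
under eq_integral do rewrite hE.
rewrite (integral_prod_Rn (c := c)).
- by rewrite /c -big_mkcond/= big_pred1_eq.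
- move=> j; apply: measurable_funM => //.
  by case: (j == k).
- by move=> j x; rewrite mulr_ge0 ?(ltW (p0 j x))//; case: ifP.
- move=> j; rewrite /h /c; case: eqVneq => [->//|_].
  by under eq_integral do rewrite mulr1; rewrite integral_npdf.
Qed.

Lemma ln_npdf_ratio (m s m' s' x : R) : 0 < s -> 0 < s' ->
  ln (npdf m s x / npdf m' s' x) =
  2^-1 * (ln (s' / s) - (x - m) ^+ 2 / s + (x - m') ^+ 2 / s').
Proof.
move=> s0 s'0; have c0 t : 0 < t -> 0 < Num.sqrt (2 * pi * t).
  by move=> t0; rewrite sqrtr_gt0 !mulr_gt0// pi_gt0.
have sq : ln (Num.sqrt (2 * pi * s') / Num.sqrt (2 * pi * s)) =
    2^-1 * ln (s' / s).
  have r0 : 0 < Num.sqrt (2 * pi * s') / Num.sqrt (2 * pi * s).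
    by rewrite divr_gt0 ?c0.
  have <- : (Num.sqrt (2 * pi * s') / Num.sqrt (2 * pi * s)) ^+ 2 = s' / s.
    rewrite expr_div_n !sqr_sqrtr ?mulr_ge0 ?pi_ge0 ?(ltW s0) ?(ltW s'0)//.
    by rewrite -mulf_div divff ?mul1r// mulf_neq0 ?pnatr_eq0// gt_eqF ?pi_gt0.
  by rewrite lnXn// -[ln _ *+ 2]mulr_natl mulrA mulVf// mul1r.
have e0 z : expR z != 0 :> R by rewrite gt_eqF// expR_gt0.
rewrite (_ : npdf m s x / _ =
    expR (- ((x - m) ^+ 2 / s) / 2 + (x - m') ^+ 2 / s' / 2) *
    (Num.sqrt (2 * pi * s') / Num.sqrt (2 * pi * s))).
  rewrite lnM ?posrE ?expR_gt0 ?divr_gt0 ?c0// expRK sq.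
  by field; rewrite !gt_eqF.
rewrite /npdf expRD (_ : expR ((x - m') ^+ 2 / s' / 2) =
    (expR (- ((x - m') ^+ 2 / s') / 2))^-1).
  by field; rewrite e0 !gt_eqF ?c0.
by rewrite -expRN mulNr opprK.
Qed.

(** The log-ratio of the two densities is a sum of quadratic functions of the
    single coordinates, so its expectation only involves the moments of order
    at most 2 of the one-dimensional marginals. *)
Lemma KL_gaussian_diag n (m s m' s' : 'rV[R]_n) :
  (forall j, 0 < s 0 j) -> (forall j, 0 < s' 0 j) ->
  (KL (lebesgue_Rn R n) (gaussian_pdf m (diag_mx s))
     (gaussian_pdf m' (diag_mx s'))
   = (2^-1 * \sum_j (ln (s' 0 j / s 0 j) - 1
        + (s 0 j + (m 0 j - m' 0 j) ^+ 2) / s' 0 j))%:E)%E.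
Proof.
move=> s0 s'0.
set p := gaussian_pdf m _; set q := gaussian_pdf m' _.
have p0 x : 0 < p x by rewrite gaussian_pdf_gt0//; exact: posdef_diag.
have q0 x : 0 < q x by rewrite gaussian_pdf_gt0//; exact: posdef_diag.
have lnE x : ln (p x / q x) = \sum_j 2^-1 * (ln (s' 0 j / s 0 j)
    - (tnth x j - m 0 j) ^+ 2 / s 0 j + (tnth x j - m' 0 j) ^+ 2 / s' 0 j).
  rewrite /p /q !gaussian_pdf_diag// -prodf_div.
  rewrite -[RHS]expRK expR_sum; congr ln; apply: eq_bigr => j _.
  rewrite -ln_npdf_ratio// lnK// posrE divr_gt0//; exact: npdf_gt0.
pose F x := \sum_j 2^-1 * (ln (s' 0 j / s 0 j) * (p x * 1)
    + (- (s 0 j)^-1) * (p x * (tnth x j - m 0 j) ^+ 2)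
    + (s' 0 j)^-1 * (p x * (tnth x j - m' 0 j) ^+ 2)).
have FE x : kl_integrand (p x) (q x) = (F x)%:E.
  rewrite /kl_integrand !gt_eqF// lnE mulr_sumr; congr EFin.
  by apply: eq_bigr => j _; ring.
have msq c : measurable_fun setT (fun x : R => (x - c) ^+ 2).
  by apply: measurable_funX; exact: measurable_funB.
suff [_ intF] : has_int (lebesgue_Rn R n) F
    (2^-1 * \sum_j (ln (s' 0 j / s 0 j) - 1
        + (s 0 j + (m 0 j - m' 0 j) ^+ 2) / s' 0 j)).
  by rewrite /KL -intF; apply: eq_integral => x _; rewrite FE.
rewrite mulr_sumr; apply: has_int_sum => j; apply: has_intZ.
have -> : ln (s' 0 j / s 0 j) - 1 + (s 0 j + (m 0 j - m' 0 j) ^+ 2) / s' 0 j =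
    ln (s' 0 j / s 0 j) * 1 + - (s 0 j)^-1 * s 0 j
    + (s' 0 j)^-1 * (s 0 j + (m 0 j - m' 0 j) ^+ 2).
  by field; rewrite !gt_eqF.
apply: has_intD; [apply: has_intD|]; apply: has_intZ.
- apply: (@gaussian_pdf_marginal _ _ _ (fun=> 1) j) => //.
  by under [X in has_int _ X]eq_fun do rewrite mulr1; exact: has_int_npdf.
- apply: (@gaussian_pdf_marginal _ _ _ (fun x => (x - m 0 j) ^+ 2) j) => //.
    by move=> x; rewrite sqr_ge0.
  exact: npdf_moment2.
- apply: (@gaussian_pdf_marginal _ _ _ (fun x => (x - m' 0 j) ^+ 2) j) => //.
    by move=> x; rewrite sqr_ge0.
  exact: npdf_moment2_center.
Qed.

End product_integrals.

Theorem proposition4p3 (R : realType) (I : countType)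
    (w : I -> R) (m sigma : I -> nat -> R) (lambda : nat -> R)
    (w_gt0 : forall i, 0 < w i)
    (w_sum1 : (\esum_(i in [set: I]) (w i)%:E = 1)%E)
    (sigma_gt0 : forall i j, 0 < sigma i j)
    (m_summable : forall i, (\sum_(0 <= j <oo) ((m i j) ^+ 2)%:E < +oo)%E)
    (sigma_summable : forall i, (\sum_(0 <= j <oo) (sigma i j)%:E < +oo)%E)
    (lambda_gt0 : forall j, 0 < lambda j)
    (lambda_summable : (\sum_(0 <= j <oo) (lambda j)%:E < +oo)%E)
    (d : nat) (d_ge1 : (1 <= d)%N)
    (dm : I -> 'rV[R]_d) (dSigma : I -> 'M[R]_d) (dw : I -> R)
    (tSigma_cov : forall i, is_covariance (trunc_diag d (sigma i) + dSigma i))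
    (tw_gt0 : forall i, 0 < w i + dw i)
    (tw_sum1 : (\esum_(i in [set: I]) (w i + dw i)%:E = 1)%E) :
  let C := trunc_diag d lambda in
  let tw := fun i => w i + dw i in
  let phi := fun i =>
    gaussian_pdf (trunc_rv d (m i)) (trunc_diag d (sigma i) + C) in
  let tphi := fun i =>
    gaussian_pdf (trunc_rv d (m i) + dm i)
                 (trunc_diag d (sigma i) + dSigma i + C) in
  let rho := mixture w phi in
  let trho := mixture tw tphi in
  (KL (lebesgue_Rn R d) rho trho <=
     KL_weights w tw +
     signed_esum (fun i => (w i)%:E * KL (lebesgue_Rn R d) (phi i) (tphi i)))%E
  /\
  (forall dsigma : I -> 'I_d -> R,
     (forall i, dSigma i = diag_mx (\row_j dsigma i j)) ->
     (forall i (j : 'I_d), 0 < sigma i j + dsigma i j) ->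
     forall i,
       KL (lebesgue_Rn R d) (phi i) (tphi i) =
       (2^-1 * \sum_(j < d)
          (dm i 0 j ^+ 2 / (sigma i j + dsigma i j + lambda j)
           + ln (1 + dsigma i j / (sigma i j + lambda j))
           - dsigma i j / (sigma i j + dsigma i j + lambda j)))%:E).
Proof.
move=> C tw phi tphi rho trho.
have tw0 i : 0 < tw i := tw_gt0 i.
have pC : posdef C by apply: posdef_diag => j; rewrite mxE.
have pS i : posdef (trunc_diag d (sigma i) + C).
  by rewrite -linearD/=; apply: posdef_diag => j; rewrite !mxE addr_gt0.
have ptS i : posdef (trunc_diag d (sigma i) + dSigma i + C).
  exact: posdef_covarianceD.
split.
  apply: KL_mixture_le => //.
  - by move=> i x; exact: gaussian_pdf_gt0.
  - by move=> i x; exact: gaussian_pdf_gt0.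
  - by move=> i; exact: measurable_gaussian_pdf.
  - by move=> i; exact: measurable_gaussian_pdf.
  - by move=> i; exact: integral_gaussian_pdf.
  - by move=> i; exact: integral_gaussian_pdf.
move=> dsigma dSigmaE sdsigma0 i.
have s0 (j : 'I_d) : 0 < sigma i j + lambda j by rewrite addr_gt0.
have s'0 (j : 'I_d) : 0 < sigma i j + dsigma i j + lambda j by rewrite addr_gt0.
rewrite /phi /tphi dSigmaE -!linearD/= KL_gaussian_diag; last 2 first.
- by move=> j; rewrite !mxE.
- by move=> j; rewrite !mxE.
congr (_ * _)%:E; apply: eq_bigr => j _; rewrite !mxE.
have -> : (sigma i j + dsigma i j + lambda j) / (sigma i j + lambda j) =
    1 + dsigma i j / (sigma i j + lambda j).
  by field; rewrite gt_eqF.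
by field; rewrite gt_eqF.
Qed.
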